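(* Let $M$ be a compact connected oriented $3$-manifold with an oriented ideal triangulation $\mathcal T$ with $v$ $0$-cells and $e$ $1$-cells, and let $\sigma$ be a $\mathbb Z/2\mathbb Z$-valued $2$-cocycle on $\widehat M$. Let $\varepsilon_1,\dots,\varepsilon_v$ be $1$-cells of $\mathcal T$ such that the inclusion into $P_2^\sigma(\mathcal T)$ of the subvariety $S=\{c\in P_2^\sigma(\mathcal T)\mid c_{\varepsilon_1}=\dots=c_{\varepsilon_v}=1\}$, followed by the quotient map $P_2^\sigma(\mathcal T)\to P_2^\sigma(\mathcal T)_{\mathrm{red}}$, is an isomorphism of varieties. Let $c\in P_2^\sigma(\mathcal T)_{\mathrm{red}}$, and let $c'=(c'_1,\dots,c'_e)\in S$ be the point corresponding to $c$ under this isomorphism. Then the Ptolemy field of $c$ is the field $\mathbb Q(c'_1,\dots,c'_e)$ generated by the Ptolemy coordinates of $c'$.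
   Context: $M$ is a compact connected oriented $3$-manifold with non-empty boundary; $\widehat M$ is the space obtained from $M$ by collapsing each boundary component (called a cusp) to a point. An ideal triangulation $\mathcal T$ of $M$ is an identification of $\widehat M$ with a space obtained from finitely many simplices $\Delta_k$ by gluing faces in pairs by affine homeomorphisms, such that the $0$-cells correspond to the boundary components of $M$. Each $\Delta_k$ is identified with a standard simplex with vertices $0,1,2,3$; $\mathcal T$ is oriented if these identifications preserve orientation. $\varepsilon_{ij,k}$ is the oriented edge of $\Delta_k$ from vertex $i$ to vertex $j$, and $\sim$ denotes identification in $\widehat M$. A $\mathbb Z/2\mathbb Z$-valued $2$-cocycle $\sigma$ on $\widehat M$ is a sign for each face of $\mathcal T$ with product $1$ over the four faces of each simplex; $\sigma_{i,k}$ is the sign of the face of $\Delta_k$ opposite vertex $i$. The Ptolemy variety $P_2^\sigma(\mathcal T)$ is the set of assignments of non-zero complex numbers $c_{ij,k}$ (Ptolemy coordinates) to the oriented edges $\varepsilon_{ij,k}$ with $c_{ij,k}=-c_{ji,k}$, $c_{ij,k}=c_{i'j',k'}$ whenever $\varepsilon_{ij,k}\sim\varepsilon_{i'j',k'}$, and for every $k$ $$\sigma_{0,k}\sigma_{3,k}c_{03,k}c_{12,k}+\sigma_{0,k}\sigma_{1,k}c_{01,k}c_{23,k}=\sigma_{0,k}\sigma_{2,k}c_{02,k}c_{13,k}.$$ Choosing an oriented representative of each $1$-cell, $P_2^\sigma(\mathcal T)\subset(\mathbb C^* )^e$ with coordinates $c_\varepsilon$ indexed by the $1$-cells. The torus $T=(\mathbb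 C^* )^v$, with coordinates indexed by the cusps, acts on $P_2^\sigma(\mathcal T)$ by $(xc)_i=x_jx_kc_i$, where $j,k$ (possibly equal) are the cusps at the ends of the $i$th $1$-cell. $P^\sigma_2(\mathcal T)_{\mathrm{red}}=P_2^\sigma(\mathcal T)/T$ is the quotient variety, whose coordinate ring is the ring of $T$-invariants of the coordinate ring of $P_2^\sigma(\mathcal T)$. The Ptolemy field of $c\in P_2^\sigma(\mathcal T)$ is $k_c=\mathbb Q(\{p(c_1,\dots,c_e)\mid p\in\mathcal O^T\})$, where $\mathcal O^T$ is the ring of $T$-invariants in $\mathcal O=\mathbb Q[c_1^{\pm1},\dots,c_e^{\pm1}]/(\text{Ptolemy relations})$. It depends only on the image of $c$ in $P_2^\sigma(\mathcal T)_{\mathrm{red}}$. *)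

(* Defs.v *)
From HB Require Import structures.
From mathcomp Require Import all_boot all_order all_fingroup all_algebra.
From mathcomp Require Import complex mpoly boolp reals.

Set Implicit Arguments.
Unset Strict Implicit.
Unset Printing Implicit Defensive.

Import GRing.Theory.
Local Open Scope ring_scope.
Local Open Scope quotient_scope.

(* A triangulation is recorded by its face pairings.  [glue k f = (k', g)] means
   that the face of Delta_k opposite vertex [f] is glued to the face of
   Delta_k' opposite vertex [g f] by the affine map sending each vertex
   [i != f] to [g i]; extending the bijection of the three vertices of a face
   by f |-> g f turns it into a permutation of {0,1,2,3}.  The simplices glued
   this way form the space M^; M itself is recovered by truncating the
   0-cells, whose links are the boundary components of M. *)
Record triangulation := Triangulation {
  ntet : nat;
  glue : 'I_ntet -> 'I_4 -> 'I_ntet * 'S_4;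
  glue_sym : forall k f,
    glue (glue k f).1 ((glue k f).2 f) = (k, ((glue k f).2^-1)%g);
  glue_irrefl : forall k f, ((glue k f).1, (glue k f).2 f) != (k, f)
}.

(* A face pairing is compatible with the standard orientations of the two
   simplices iff it reverses the induced orientations of the faces, i.e. iff
   the vertex permutation above is odd. *)
Definition oriented (T : triangulation) : Prop :=
  forall (k : 'I_(ntet T)) (f : 'I_4), odd_perm (glue k f).2.

Definition connected (T : triangulation) : Prop :=
  (0 < ntet T)%N /\
  forall k k' : 'I_(ntet T),
    connect (fun a b => [exists f, (glue a f).1 == b]) k k'.

Section Cells.
Variable T : triangulation.

Definition tvertex : finType := ('I_(ntet T) * 'I_4)%type.

(* (k, (i, j)) is the oriented edge eps_{ij,k} of Delta_k. *)
Definition oedge : finType :=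
  {a : 'I_(ntet T) * ('I_4 * 'I_4) | a.2.1 != a.2.2}.

Definition mk_oedge (k : 'I_(ntet T)) (i j : 'I_4) (ij : i != j) : oedge :=
  Sub (k, (i, j)) ij.

Definition otet (a : oedge) : 'I_(ntet T) := (val a).1.
Definition osrc (a : oedge) : 'I_4 := (val a).2.1.
Definition otgt (a : oedge) : 'I_4 := (val a).2.2.

Lemma oedge_revP (a : oedge) : otgt a != osrc a.
Proof. by rewrite eq_sym; exact: (valP a). Qed.

Definition orev (a : oedge) : oedge := mk_oedge (otet a) (oedge_revP a).

Definition vertex_step : rel tvertex := fun a b =>
  [exists f, (f != a.2) && (b == ((glue a.1 f).1, (glue a.1 f).2 a.2))].

Definition edge_step : rel oedge := fun a b =>
  [exists f, [&& f != osrc a, f != otgt a &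
    val b == ((glue (otet a) f).1,
              ((glue (otet a) f).2 (osrc a), (glue (otet a) f).2 (otgt a)))]].

(* Identification in M^.  The one-step relations are symmetric by
   [glue_sym], so [connect] is the generated equivalence relation. *)
Definition vertex_sim : rel tvertex := connect vertex_step.
Definition edge_sim : rel oedge := connect edge_step.

(* A numbering of the v 0-cells and of the e 1-cells.  [cusp] sends a vertex
   of a simplex to its 0-cell; [cell1 i] is the chosen oriented representative
   of the i-th 1-cell. *)
Record cell_numbering (v e : nat) := CellNumbering {
  cusp : tvertex -> 'I_v;
  cell1 : 'I_e -> oedge;
  cuspP : forall a b, (cusp a == cusp b) = vertex_sim a b;
  cusp_surj : forall j, exists a, cusp a = j;
  cell1P : forall a,
    exists! i, edge_sim a (cell1 i) \/ edge_sim (orev a) (cell1 i)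
}.

(* [cocycle_sgn k i] belongs to the face opposite vertex i of Delta_k, and
   Z/2 is written additively as [bool]: the sign is (-1) ^+ cocycle_sgn k i. *)
Record cocycle := Cocycle {
  cocycle_sgn : 'I_(ntet T) -> 'I_4 -> bool;
  cocycle_glue : forall k f,
    cocycle_sgn (glue k f).1 ((glue k f).2 f) = cocycle_sgn k f;
  cocycle_closed : forall k, \big[addb/false]_(i < 4) cocycle_sgn k i = false
}.

Definition v0 : 'I_4 := @Ordinal 4 0 isT.
Definition v1 : 'I_4 := @Ordinal 4 1 isT.
Definition v2 : 'I_4 := @Ordinal 4 2 isT.
Definition v3 : 'I_4 := @Ordinal 4 3 isT.

Section PtolemyRelation.
Variables (A : comNzRingType) (sigma : cocycle) (c : oedge -> A).
Variable k : 'I_(ntet T).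

Definition face_sign (i : 'I_4) : A := (-1) ^+ cocycle_sgn sigma k i.

Definition pc (i j : 'I_4) (ij : i != j) : A := c (mk_oedge k ij).

Definition ptolemy_lhs : A :=
  face_sign v0 * face_sign v3 * @pc v0 v3 isT * @pc v1 v2 isT
  + face_sign v0 * face_sign v1 * @pc v0 v1 isT * @pc v2 v3 isT.

Definition ptolemy_rhs : A :=
  face_sign v0 * face_sign v2 * @pc v0 v2 isT * @pc v1 v3 isT.
End PtolemyRelation.

End Cells.

(* A variety given by its points and its ring of regular functions, as for
   classical affine varieties over C. *)
Record variety (C : Type) := Variety {
  point :> Type;
  regular : (point -> C) -> Prop
}.

Definition is_morphism (C : Type) (X Y : variety C) (f : X -> Y) : Prop :=
  forall h : Y -> C, regular h -> @regular C X (h \o f).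

Definition is_isomorphism (C : Type) (X Y : variety C) (f : X -> Y) : Prop :=
  is_morphism f /\
  exists g : Y -> X, [/\ is_morphism g, cancel f g & cancel g f].

Section Laurent.
Variable e : nat.

(* K[c_1^{+-1},...,c_e^{+-1}] is represented as the quotient of the polynomial
   ring in the 2e variables c_1,...,c_e,d_1,...,d_e by the relations
   c_i * d_i = 1; representatives are used throughout. *)
Definition laurent (K : nzRingType) : Type := {mpoly K[e + e]}.

Definition laurent_point (K : fieldType) (c : 'I_e -> K) : 'I_(e + e) -> K :=
  fun l => match split l with inl i => c i | inr i => (c i)^-1 end.

Definition laurent_eval (K : fieldType) (p : laurent K) (c : 'I_e -> K) : K :=
  p.@[laurent_point c].

(* p(c_1,...,c_e) |-> p(w_1 c_1,...,w_e c_e) *)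
Definition laurent_scale (K : fieldType) (w : 'I_e -> K) (p : laurent K) :
    laurent K :=
  p \mPo [tuple laurent_point w l *: 'X_l | l < e + e].

(* A set with coordinates in (K^* )^e, with the restrictions of Laurent
   polynomials as regular functions. *)
Definition torus_subvariety (K : fieldType) (X : Type)
    (coords : X -> 'I_e -> K) : variety K :=
  @Variety K X (fun f =>
    exists p : laurent K, forall x, f x = laurent_eval p (coords x)).

End Laurent.

Section Ptolemy.
Variables (R : realType) (T : triangulation) (sigma : cocycle T).
Variables (v e : nat) (N : cell_numbering T v e).

Local Notation C := (R[i]).

Record ptolemy_assignment (c : oedge T -> C) : Prop := PtolemyAssignment {
  ptolemy_neq0 : forall a, c a != 0;
  ptolemy_anti : forall a, c a = - c (orev a);
  ptolemy_sim : forall a b, edge_sim a b -> c a = c b;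
  ptolemy_eq : forall k, ptolemy_lhs sigma c k = ptolemy_rhs sigma c k
}.

Definition ptolemy_set : choiceType :=
  {c : {ffun oedge T -> C} | `[< ptolemy_assignment c >]}.

Definition ptolemy_coords (c : ptolemy_set) : 'I_e -> C :=
  fun i => val c (cell1 N i).

Definition ptolemy_variety : variety C := torus_subvariety ptolemy_coords.

(* The scalar by which x in (C^* )^v acts on the coordinate of a 1-cell. *)
Definition torus_weight (x : 'I_v -> C) (i : 'I_e) : C :=
  let a := cell1 N i in
  x (cusp N (otet a, osrc a)) * x (cusp N (otet a, otgt a)).

Definition in_torus (x : 'I_v -> C) : Prop := forall j, x j != 0.

Definition same_orbit (c c' : ptolemy_set) : bool :=
  `[< exists x, in_torus x /\
        forall i, ptolemy_coords c' i = torus_weight x i * ptolemy_coords c i >].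

Lemma same_orbit_refl : reflexive same_orbit.
Proof.
move=> c; apply/asboolP; exists (fun=> 1); split=> [j|i].
  exact: oner_neq0.
by rewrite /torus_weight !mul1r.
Qed.

Lemma torus_weightV x i :
  torus_weight (fun j => (x j)^-1) i = (torus_weight x i)^-1.
Proof. by rewrite /torus_weight invfM. Qed.

Lemma torus_weight_neq0 x i : in_torus x -> torus_weight x i != 0.
Proof. by move=> xT; rewrite mulf_neq0. Qed.

Lemma same_orbit_sym : ssrbool.symmetric same_orbit.
Proof.
suff H c c' : same_orbit c c' -> same_orbit c' c.
  by move=> c c'; apply/idP/idP; exact: H.
move=> /asboolP[x [xT xE]]; apply/asboolP; exists (fun j => (x j)^-1).
split=> [j|i]; first by rewrite invr_neq0.
by rewrite torus_weightV xE mulKf // torus_weight_neq0.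
Qed.

Lemma same_orbit_trans : transitive same_orbit.
Proof.
move=> c' c c'' /asboolP[x [xT xE]] /asboolP[y [yT yE]].
apply/asboolP; exists (fun j => y j * x j); split=> [j|i].
  by rewrite mulf_neq0.
by rewrite yE xE mulrA /torus_weight; congr (_ * _); rewrite mulrACA.
Qed.

Canonical same_orbit_equiv :=
  EquivRel same_orbit same_orbit_refl same_orbit_sym same_orbit_trans.

Definition ptolemy_quot : Type := {eq_quot same_orbit_equiv}.

Definition ptolemy_proj (c : ptolemy_set) : ptolemy_quot :=
  \pi_({eq_quot same_orbit_equiv}) c.

(* All T-orbits have the same stabilizer, hence are closed in the Ptolemy
   variety, so the points of the quotient variety are the orbits.  Composing
   with [ptolemy_proj] identifies the functions declared regular here with the
   T-invariant regular functions on the Ptolemy variety. *)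
Definition ptolemy_red : variety C :=
  @Variety C ptolemy_quot (fun f => @regular C ptolemy_variety (f \o ptolemy_proj)).

Variable eps : 'I_v -> 'I_e.

Definition slice_set : Type :=
  {c : ptolemy_set | [forall j, ptolemy_coords c (eps j) == 1]}.

Definition slice_incl (c : slice_set) : ptolemy_set := val c.

Definition slice : variety C :=
  torus_subvariety (fun c : slice_set => ptolemy_coords (slice_incl c)).

Definition slice_to_red (c : slice) : ptolemy_red := ptolemy_proj (slice_incl c).

Section CoordinateRing.
Variable K : fieldType.

(* The i-th coordinate and its inverse. *)
Definition lX (i : 'I_e) : laurent e K := 'X_(lshift e i).
Definition lXV (i : 'I_e) : laurent e K := 'X_(rshift e i).

(* The coordinate c_a of an oriented edge a in terms of those of the 1-cells:
   exactly one term occurs, c_i if a ~ cell1 i and - c_i if a ~ the reverse of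
   cell1 i (not both, T being oriented). *)
Definition lcoord (a : oedge T) : laurent e K :=
  \sum_(i | edge_sim a (cell1 N i)) lX i
  - \sum_(i | edge_sim (orev a) (cell1 N i)) lX i.

(* Membership in the ideal generated by the relations c_i d_i = 1 and by the
   Ptolemy relations; the coordinate ring is the quotient by it. *)
Definition in_ptolemy_ideal (p : laurent e K) : Prop :=
  exists (a : 'I_e -> laurent e K) (b : 'I_(ntet T) -> laurent e K),
    p = \sum_i a i * (lX i * lXV i - 1)
      + \sum_k b k * (ptolemy_lhs sigma lcoord k - ptolemy_rhs sigma lcoord k).
End CoordinateRing.

Definition lC (p : laurent e rat) : laurent e C := map_mpoly ratr p.

(* p represents an element of O^T: its class in O is fixed by every x in
   T = (C^* )^v, which acts on the complexification C[c_i^{+-1}]/(Ptolemy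
   relations) of O. *)
Definition torus_invariant (p : laurent e rat) : Prop :=
  forall x, in_torus x ->
    in_ptolemy_ideal (laurent_scale (torus_weight x) (lC p) - lC p).

(* The subfield of C generated by a subset. *)
Definition subfield_gen (A : C -> Prop) (z : C) : Prop :=
  forall F : {pred C},
    GRing.divring_closed F -> (forall a, A a -> a \in F) -> z \in F.

Definition ptolemy_field (c : ptolemy_set) : C -> Prop :=
  subfield_gen (fun z =>
    exists2 p, torus_invariant p & z = laurent_eval (lC p) (ptolemy_coords c)).

Definition coords_field (c : ptolemy_set) : C -> Prop :=
  subfield_gen (fun z => exists i, z = ptolemy_coords c i).

End Ptolemy.

(* Main.v *)
From HB Require Import structures.
Require Import Defs.
From mathcomp Require Import all_boot all_order all_algebra complex reals.
From mathcomp Require Import perm cyclic separable cyclotomic mpoly boolp.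
From mathcomp Require Import ring.

(** Fix a point c' of the slice S, the set of points whose coordinates c_(eps j)
    are 1.  The isomorphism being injective on points, two points of S in one
    T-orbit are equal.  If x in T acts trivially on each
    c_(eps j), then x c' is again in S and lies in the orbit of c', so x c' = c'
    and, the coordinates of c' being nonzero, x acts trivially on all the
    coordinates ([slice_weights_span]).  Thus the weights of the coordinates
    c_i are characters of T that are trivial on the common kernel of the
    weights of the c_(eps j).  Over an algebraically closed field of
    characteristic 0 such characters lie in the lattice that those weights
    generate ([character_lattice], by the Smith normal form).

    So for each i there are integers a_j such that the Laurent monomial
    c_i * prod_j c_(eps j)^(- a_j) has weight 0.  It has rational coefficients
    and is invariant in the coordinate ring itself, whether or not that ring is
    reduced, and its value at c' is c'_i.  Hence the Ptolemy field, which may be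
    computed at any point of the orbit ([torus_invariant_eval]), contains all
    the c'_i.  Conversely the value at c' of any rational Laurent polynomial
    lies in the field generated by the c'_i ([laurent_eval_rat_mem]). *)

Import GRing.Theory Num.Theory.
Local Open Scope ring_scope.

Set Implicit Arguments.
Unset Strict Implicit.

(** * Characters of a torus *)

Section Characters.
Variable K : fieldType.

Definition character m (x : 'I_m -> K) (u : 'rV[int]_m) : K :=
  \prod_k x k ^ u 0 k.

Definition monomial_map m n (A : 'M[int]_(n, m)) (x : 'I_m -> K) : 'I_n -> K :=
  fun j => character x (row j A).

Lemma character_neq0 m (x : 'I_m -> K) u :
  (forall k, x k != 0) -> character x u != 0.
Proof. by move=> x0; apply/prodf_neq0 => k _; rewrite expfz_neq0. Qed.

Lemma characterD m (x : 'I_m -> K) u w : (forall k, x k != 0) ->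
  character x (u + w) = character x u * character x w.
Proof.
move=> x0; rewrite -big_split; apply: eq_bigr => k _.
by rewrite mxE expfzDr.
Qed.

Lemma character_delta m (x : 'I_m -> K) j : character x (delta_mx 0 j) = x j.
Proof.
rewrite /character (bigD1 j) //= mxE !eqxx expr1z big1 ?mulr1 // => k kj.
by rewrite mxE (negPf kj) andbF expr0z.
Qed.

(** Pulling a character back along the homomorphism of tori with matrix A
    multiplies its exponent vector by A: this turns changes of coordinates of
    the torus into products of integer matrices. *)
Lemma character_monomial_map m n (A : 'M[int]_(n, m)) (x : 'I_m -> K) u :
  (forall k, x k != 0) -> character (monomial_map A x) u = character x (u *m A).
Proof.
move=> x0; rewrite /character /monomial_map /character.
transitivity (\prod_(j < n) \prod_(k < m) x k ^ (u 0 j * A j k)).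
  apply: eq_bigr => j _.
  elim/big_rec2: _ => [|k y1 y2 _ <-]; first by rewrite exp1rz.
  by rewrite expfzMl exprz_exp mxE mulrC [A j k * _]mulrC mulrC.
rewrite exchange_big; apply: eq_bigr => k _; rewrite mxE.
by elim/big_rec2: _ => [|j y1 y2 _ ->]; rewrite ?expr0z // expfzDr.
Qed.

End Characters.

(** As n is invertible, X^n - 1 has n distinct roots, and a finite group of roots of unity
    is cyclic. *)
Lemma prim_root_exists (K : closedFieldType) n :
  n%:R != 0 :> K -> exists z : K, n.-primitive_root z.
Proof.
move=> nK; have n_gt0 : (0 < n)%N.
  by rewrite lt0n; apply: contra_neq nK => ->.
have [r Dp] := closed_field_poly_normal ('X^n - 1 : {poly K}).
rewrite (monicP _) ?monicXnsubC // scale1r in Dp.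
have rn1 : all n.-unity_root r by apply/allP=> z; rewrite -root_prod_XsubC -Dp.
have sz_r : (n < (size r).+1)%N.
  by rewrite -(size_prod_XsubC r id) -Dp size_XnsubC.
have [|z] := hasP (has_prim_root n_gt0 rn1 _ sz_r); last by exists z.
by rewrite -separable_prod_XsubC -Dp separable_Xn_sub_1.
Qed.

(** The multiplicative group contains elements of every order; d = 0 stands for
    infinite order. *)
Lemma exists_order (K : numClosedFieldType) (d : int) :
  exists2 z : K, z != 0 & forall n : int, (z ^ n == 1) = (d %| n)%Z.
Proof.
have [-> | d0] := eqVneq d 0.
  exists 2; first by rewrite pnatr_eq0.
  move=> n; rewrite dvd0z pexprz_eq1 ?ler0n //.
  by rewrite -[1]/(1%:R) eqr_nat orbF.
have [|z zP] := @prim_root_exists K `|d|; first by rewrite pnatr_eq0 absz_eq0.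
have z0 : z != 0.
  apply: contra_eq_neq (prim_expr_order zP) => ->.
  by rewrite expr0n absz_eq0 (negPf d0) eq_sym oner_eq0.
exists z => // -[n|n]; rewrite dvdzE (prim_order_dvd zP) //=.
by rewrite -[z ^ Negz n]/((z ^+ n.+1)^-1) invr_eq1.
Qed.

(** A character that is trivial on the common kernel of the characters given by
    the rows of A is a product of powers of them.  In the torus coordinates that
    put A in Smith normal form the common kernel is a product of groups of roots
    of unity and of copies of K^*.  Testing the character on a root of unity of
    maximal order in each of the former, and on an element of infinite order in
    each of the latter, gives the divisibilities needed to solve u = a *m A. *)
Lemma character_lattice (K : numClosedFieldType) m n (A : 'M[int]_(n, m))
    (u : 'rV[int]_m) :
  (forall x : 'I_m -> K, (forall k, x k != 0) ->
     (forall j, monomial_map A x j = 1) -> character x u = 1) ->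
  exists a, u = a *m A.
Proof.
move=> triv; have [L uL [Q uQ [d _ DA]]] := int_Smith_normal_form A.
set D := \matrix_(i, j) _ in DA.
pose w := u *m invmx Q.
(* The k-th diagonal entry of D is d`_k only if D has a k-th row; the columns
   of D beyond the last row are zero. *)
have dvd_d (k : 'I_m) : (d`_k *+ (k < n) %| w 0%R k)%Z.
  have [z z0 zP] := exists_order K (d`_k *+ (k < n)).
  pose y (l : 'I_m) := if l == k then z else 1.
  have y0 l : y l != 0 by rewrite /y; case: ifP => _; rewrite ?oner_neq0 ?z0.
  have yE t : character y t = z ^ t 0 k.
    rewrite /character (bigD1 k) //= {1}/y eqxx big1 ?mulr1 // => l lk.
    by rewrite /y (negPf lk) exp1rz.
  rewrite -zP -yE -character_monomial_map //; apply/eqP/triv => [l|j].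
    exact: character_neq0.
  (* The test point, obtained from y by the change of coordinates invmx Q, lies
     in the common kernel, since the order of z divides the k-th column of
     L *m D. *)
  rewrite /monomial_map character_monomial_map // yE; apply/eqP; rewrite zP.
  rewrite {1}DA -row_mul -!mulmxA mulmxV // mulmx1 mxE mxE.
  apply: rpred_sum => i _.
  rewrite !mxE dvdz_mull //; case: eqP => [ik|]; last by rewrite dvdz0.
  by rewrite -ik ltn_ord ?dvdzz.
have -> : u = w *m Q by rewrite mulmxKV.
clearbody w; clear triv.
pose b : 'rV_n := \row_j oapp (fun k => (w 0%R k %/ d`_k)%Z) 0 (insub (val j)).
exists (b *m invmx L); rewrite {1}DA !mulmxA mulmxKV //.
congr (_ *m Q); apply/rowP => k; rewrite [RHS]mxE; have := dvd_d k.
have [kn|kn] := ltnP k n.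
  rewrite mulr1n => dk; rewrite (bigD1 (Ordinal kn)) //= big1 => [|j jk].
    by rewrite !mxE eqxx mulr1n addr0 [val _]/(val k) valK /= divzK.
  rewrite !mxE (_ : (j == k :> nat) = false) ?mulr0 //.
  by apply: contraNF jk => /eqP jk; apply/eqP/val_inj.
rewrite mulr0n dvd0z => /eqP->; rewrite big1 // => j _.
rewrite !mxE (_ : (j == k :> nat) = false) ?mulr0 //.
by apply: contraTF (ltn_ord j) => /eqP->; rewrite -leqNgt.
Qed.

(** * Laurent monomials *)

Section LaurentEvaluation.
Variables (K : fieldType) (e : nat).
Implicit Types (p q : laurent e K) (c w : 'I_e -> K).

Lemma laurent_evalB p q c :
  laurent_eval (p - q) c = laurent_eval p c - laurent_eval q c.
Proof. exact: mevalB. Qed.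

Lemma eq_laurent_eval c1 c2 p :
  c1 =1 c2 -> laurent_eval p c1 = laurent_eval p c2.
Proof.
by move=> Ec; apply: meval_eq => l; rewrite /laurent_point; case: (split l) => i; rewrite Ec.
Qed.

Lemma laurent_eval_scale w p c :
  laurent_eval (laurent_scale w p) c = laurent_eval p (fun i => w i * c i).
Proof.
rewrite /laurent_eval /laurent_scale comp_mpoly_meval; apply: meval_eq => l.
rewrite tnth_mktuple mevalZ mevalXU /laurent_point.
by case: (split l) => i; rewrite ?invfM.
Qed.

Lemma laurent_eval_lX i c : laurent_eval (lX K i) c = c i.
Proof.
by rewrite /laurent_eval mevalXU /laurent_point -[lshift e i]/(unsplit (inl i))
  unsplitK.
Qed.

Lemma laurent_eval_lXV i c : laurent_eval (lXV K i) c = (c i)^-1.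
Proof.
by rewrite /laurent_eval mevalXU /laurent_point -[rshift e i]/(unsplit (inr i))
  unsplitK.
Qed.

End LaurentEvaluation.

(** The power of a coordinate with an integer exponent; negative powers use the
    variable that stands for the inverse of the coordinate, so that the torus
    acts on the representative by a scalar. *)
Definition lXz e (K : fieldType) (i : 'I_e) (n : int) : laurent e K :=
  match n with Posz n => lX K i ^+ n | Negz n => lXV K i ^+ n.+1 end.

Lemma laurent_eval_lXz (K : fieldType) e (i : 'I_e) n (c : 'I_e -> K) :
  laurent_eval (lXz K i n) c = c i ^ n.
Proof.
case: n => n; rewrite /laurent_eval rmorphXn /= -/(laurent_eval _ _).
  by rewrite laurent_eval_lX.
by rewrite laurent_eval_lXV exprVn.
Qed.

Lemma laurent_scale_lX (K : fieldType) e (i : 'I_e) (w : 'I_e -> K) :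
  laurent_scale w (lX K i) = w i *: lX K i.
Proof.
rewrite /laurent_scale comp_mpolyXU -tnth_nth tnth_mktuple /laurent_point.
by rewrite -[lshift e i]/(unsplit (inl i)) unsplitK.
Qed.

Lemma laurent_scale_lXV (K : fieldType) e (i : 'I_e) (w : 'I_e -> K) :
  laurent_scale w (lXV K i) = (w i)^-1 *: lXV K i.
Proof.
rewrite /laurent_scale comp_mpolyXU -tnth_nth tnth_mktuple /laurent_point.
by rewrite -[rshift e i]/(unsplit (inr i)) unsplitK.
Qed.

Lemma laurent_scale_lXz (K : fieldType) e (i : 'I_e) n (w : 'I_e -> K) :
  laurent_scale w (lXz K i n) = w i ^ n *: lXz K i n.
Proof.
case: n => n; rewrite /laurent_scale rmorphXn /= -/(laurent_scale _ _).
  by rewrite laurent_scale_lX exprZn.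
by rewrite laurent_scale_lXV exprZn exprVn.
Qed.

(** The candidate for an invariant that takes the value c_i on the slice: the
    factors in the c_(eps j) compensate the weight of c_i and are 1 there. *)
Definition monomial_ratio v e (K : fieldType) (eps : 'I_v -> 'I_e) (i : 'I_e)
    (a : 'I_v -> int) : laurent e K :=
  lX K i * \prod_j lXz K (eps j) (- a j).

Lemma laurent_eval_monomial_ratio v e (K : fieldType) (eps : 'I_v -> 'I_e) i a
    (c : 'I_e -> K) :
  laurent_eval (monomial_ratio K eps i a) c = c i * \prod_j c (eps j) ^ (- a j).
Proof.
rewrite /laurent_eval rmorphM rmorph_prod /= -!/(laurent_eval _ _).
rewrite laurent_eval_lX; congr (_ * _); apply: eq_bigr => j _.
exact: laurent_eval_lXz.
Qed.

Lemma laurent_scale_monomial_ratio v e (K : fieldType) (eps : 'I_v -> 'I_e) i a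
    (w : 'I_e -> K) :
  laurent_scale w (monomial_ratio K eps i a) =
    (w i * \prod_j w (eps j) ^ (- a j)) *: monomial_ratio K eps i a.
Proof.
rewrite /laurent_scale rmorphM rmorph_prod /= -!/(laurent_scale _ _).
rewrite laurent_scale_lX (eq_bigr _ (fun j _ => laurent_scale_lXz _ _ _)).
by rewrite scaler_prod -scalerAl -scalerAr scalerA.
Qed.

Lemma lC_lXz (R : realType) e (i : 'I_e) n : lC R (lXz rat i n) = lXz R[i] i n.
Proof. by case: n => n; rewrite /lC rmorphXn /= map_mpolyX. Qed.

Lemma lC_monomial_ratio (R : realType) v e (eps : 'I_v -> 'I_e) i a :
  lC R (monomial_ratio rat eps i a) = monomial_ratio R[i] eps i a.
Proof.
rewrite /lC rmorphM rmorph_prod /= map_mpolyX; congr (_ * _).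
by apply: eq_bigr => j _; exact: lC_lXz.
Qed.

Lemma laurent_eval_rat_mem (R : realType) e (F : {pred R[i]}) (p : laurent e rat)
    (c : 'I_e -> R[i]) :
  GRing.divring_closed F -> (forall i, c i \in F) ->
  laurent_eval (lC R p) c \in F.
Proof.
move=> divF cF.
(* Packaging F as a closed predicate makes the generic closure lemmas apply. *)
pose isF := GRing.isDivringClosed.Build _ F divF.
pose DF : divringClosed R[i] := HB.pack F isF.
change (laurent_eval (lC R p) c \in DF).
rewrite /laurent_eval mevalE rpred_sum // => m _; rewrite rpredM //.
  by rewrite mcoeff_map_mpoly rpred_rat.
rewrite rpred_prod // => l _; rewrite rpredX // /laurent_point.
by case: (split l) => i; rewrite ?rpredV; exact: cF.
Qed.

(** * The torus action on the Ptolemy variety *)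

Lemma rmorph_ptolemy (A B : comNzRingType) (f : {rmorphism A -> B})
    (T : triangulation) (sigma : cocycle T) (c : oedge T -> A) k :
  f (ptolemy_lhs sigma c k - ptolemy_rhs sigma c k) =
    ptolemy_lhs sigma (f \o c) k - ptolemy_rhs sigma (f \o c) k.
Proof. by rewrite rmorphB rmorphD !rmorphM !rmorph_sign. Qed.

Section PtolemyVariety.
Variables (R : realType) (T : triangulation) (sigma : cocycle T).
Variables (v e : nat) (N : cell_numbering T v e).
Local Notation C := R[i].
Local Notation P := (ptolemy_set R sigma).
Implicit Types (c : P) (x : 'I_v -> C) (p : laurent e rat).

Definition oedge_weight x (a : oedge T) : C :=
  x (cusp N (otet a, osrc a)) * x (cusp N (otet a, otgt a)).

Lemma edge_sim_cusp (a b : oedge T) : edge_sim a b ->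
  cusp N (otet a, osrc a) = cusp N (otet b, osrc b) /\
  cusp N (otet a, otgt a) = cusp N (otet b, otgt b).
Proof.
move=> /connectP[s].
elim: s a => [|a' s IH] a /= => [_ -> //|/andP[/existsP[f] aa' sP] bE].
have [<- <-] := IH _ sP bE; case/and3P: aa' => fs ft /eqP a'E.
have cuspE i : f != i -> cusp N (otet a, i) =
    cusp N ((glue (otet a) f).1, (glue (otet a) f).2 i).
  move=> fi; apply/eqP; rewrite cuspP; apply: connect1.
  by apply/existsP; exists f; rewrite fi eqxx.
by rewrite /otet /osrc /otgt a'E /= -!cuspE.
Qed.

(** The weight of an oriented edge depends only on its class, its endpoints being
    sent to equal cusps, and each term of the Ptolemy relation of a simplex
    involves every vertex once, so the relation is homogeneous of weight
    x0 x1 x2 x3. *)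
Lemma torus_action_subproof x c : in_torus x ->
  `[< ptolemy_assignment sigma [ffun a => oedge_weight x a * val c a] >].
Proof.
move=> xT; have /asboolP[c0 cN cS cE] := valP c.
apply/asboolP; split=> [a|a|a b ab|k]; rewrite ?ffunE.
- by rewrite !mulf_neq0.
- by rewrite cN mulrN /oedge_weight /orev /= [x _ * x _ in RHS]mulrC.
- by rewrite (cS _ _ ab) /oedge_weight; have [-> ->] := edge_sim_cusp ab.
rewrite /ptolemy_lhs /ptolemy_rhs /pc !ffunE /oedge_weight /=.
rewrite /otet /osrc /otgt /=.
set x0 := x (cusp N (k, v0)); set x1 := x (cusp N (k, v1)).
set x2 := x (cusp N (k, v2)); set x3 := x (cusp N (k, v3)).
transitivity (x0 * x1 * x2 * x3 * ptolemy_lhs sigma (val c) k).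
  by rewrite /ptolemy_lhs /pc; ring.
by rewrite cE /ptolemy_rhs /pc; ring.
Qed.

Definition torus_action x (xT : in_torus x) c : P :=
  Sub [ffun a => oedge_weight x a * val c a] (torus_action_subproof c xT).

Lemma ptolemy_coords_action x (xT : in_torus x) c i :
  ptolemy_coords N (torus_action xT c) i =
    torus_weight N x i * ptolemy_coords N c i.
Proof. by rewrite /ptolemy_coords /= ffunE. Qed.

Lemma ptolemy_proj_eq c1 c2 :
  ptolemy_proj N c1 = ptolemy_proj N c2 -> same_orbit N c1 c2.
Proof. by move/eqP; rewrite eqmodE. Qed.

(** * Invariants *)

(** At a point of the Ptolemy variety an edge cannot be identified with its
    reverse, as its coordinate would equal its own opposite; so exactly one
    term of [lcoord] survives. *)
Lemma lcoordE c (a : oedge T) :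
  laurent_eval (lcoord N C a) (ptolemy_coords N c) = val c a.
Proof.
have /asboolP[c0 cN cS _] := valP c.
rewrite /laurent_eval /lcoord mevalB !rmorph_sum /=.
under eq_bigr do rewrite -/(laurent_eval _ _) laurent_eval_lX.
under [X in _ - X]eq_bigr do rewrite -/(laurent_eval _ _) laurent_eval_lX.
have notboth i : edge_sim a (cell1 N i) -> edge_sim (orev a) (cell1 N i) -> False.
  move=> /cS ai /cS ri; have /eqP := cN a; rewrite ri -ai -addr_eq0.
  by rewrite -mulr2n mulrn_eq0 /= (negPf (c0 a)).
have [i [ai uniq_i]] := cell1P N a.
case: ai => ai.
  rewrite (bigD1 i) //= big1 => [|j /andP[aj /eqP[]]]; last first.
    by rewrite (uniq_i j) //; left.
  rewrite big1 => [|j aj]; last first.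
    have ij := uniq_i j (or_intror aj).
    by rewrite -ij in aj; case: (notboth _ ai aj).
  by rewrite addr0 subr0 /ptolemy_coords (cS _ _ ai).
rewrite big1 => [|j aj]; last first.
  have ij := uniq_i j (or_introl aj).
  by rewrite -ij in aj; case: (notboth _ aj ai).
rewrite (bigD1 i) //= big1 => [|j /andP[aj /eqP[]]]; last first.
  by rewrite (uniq_i j) //; right.
by rewrite addr0 sub0r /ptolemy_coords -(cS _ _ ai) -cN.
Qed.

Lemma ptolemy_ideal_eval0 c (q : laurent e C) :
  in_ptolemy_ideal sigma N q -> laurent_eval q (ptolemy_coords N c) = 0.
Proof.
have /asboolP[c0 _ _ cE] := valP c.
case=> a [b ->]; rewrite /laurent_eval mevalD !rmorph_sum /=.
rewrite !big1 ?addr0 // => [k|i] _; rewrite mevalM.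
  rewrite rmorph_ptolemy (_ : _ \o _ = val c) ?cE ?subrr ?mulr0 //.
  by apply/funext => b'; exact: lcoordE.
rewrite mevalB mevalM meval1 -!/(laurent_eval _ _) laurent_eval_lX laurent_eval_lXV.
by rewrite mulfV ?subrr ?mulr0 // /ptolemy_coords c0.
Qed.

(** Invariance holds modulo the ideal of relations, which vanishes on the Ptolemy
    variety, so it gives equality of values along orbits. *)
Lemma torus_invariant_eval p c1 c2 : torus_invariant R sigma N p ->
  same_orbit N c1 c2 ->
  laurent_eval (lC R p) (ptolemy_coords N c1) =
  laurent_eval (lC R p) (ptolemy_coords N c2).
Proof.
move=> pinv /asboolP[x [xT xE]].
have := ptolemy_ideal_eval0 c1 (pinv x xT).
rewrite laurent_evalB => /subr0_eq/esym pE; apply: etrans pE _.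
apply: etrans (laurent_eval_scale _ _ _) _.
by apply: eq_laurent_eval => i; rewrite xE.
Qed.

Definition cusp_weight (i : 'I_e) : 'rV[int]_v :=
  let a := cell1 N i in
  delta_mx 0 (cusp N (otet a, osrc a)) + delta_mx 0 (cusp N (otet a, otgt a)).

Lemma torus_weightE x i : in_torus x ->
  torus_weight N x i = character x (cusp_weight i).
Proof. by move=> xT; rewrite characterD // !character_delta. Qed.

(** Translating c' by an element of the common kernel of the weights of the
    c_(eps j) stays in the slice and in the orbit of c', hence fixes c' and its
    nonzero coordinates: the kernel is contained in that of every weight. *)
Lemma slice_weights_span (eps : 'I_v -> 'I_e) (c' : slice R sigma N eps) :
  injective (@slice_to_red R T sigma v e N eps) ->
  forall i, exists a : 'I_v -> int, forall x, in_torus x ->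
    torus_weight N x i = \prod_j torus_weight N x (eps j) ^ a j.
Proof.
move=> inj i.
have [x xT x1|a aE] := @character_lattice C v v
    (\matrix_j cusp_weight (eps j)) (cusp_weight i).
  have weps j : torus_weight N x (eps j) = 1.
    by rewrite torus_weightE // -(x1 j) /monomial_map rowK.
  have xc'S : [forall j, ptolemy_coords N
      (torus_action xT (slice_incl c')) (eps j) == 1].
    apply/forallP => j; rewrite ptolemy_coords_action weps mul1r.
    exact: (forallP (valP c')).
  pose xc' : slice R sigma N eps := Sub (torus_action xT (slice_incl c')) xc'S.
  have E : c' = xc'.
    apply: inj; apply/eqP; rewrite eqmodE; apply/asboolP.
    by exists x; split=> // k; exact: ptolemy_coords_action.
  have := congr1 (fun s => ptolemy_coords N (slice_incl s) i) E.
  rewrite [RHS]ptolemy_coords_action torus_weightE // -[LHS]mul1r.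
  have /asboolP[c'0 _ _ _] := valP (slice_incl c').
  by move=> /(mulIf (c'0 _)).
exists (a 0) => x xT.
rewrite (torus_weightE i xT) aE -character_monomial_map //.
apply: eq_bigr => j _.
by rewrite (torus_weightE (eps j) xT) /monomial_map rowK.
Qed.

(** The torus fixes this monomial itself, not only its class, so the difference
    to be placed in the ideal is 0. *)
Lemma monomial_ratio_invariant (eps : 'I_v -> 'I_e) i (a : 'I_v -> int) :
  (forall x, in_torus x ->
    torus_weight N x i = \prod_j torus_weight N x (eps j) ^ a j) ->
  torus_invariant R sigma N (monomial_ratio rat eps i a).
Proof.
move=> wE x xT; rewrite lC_monomial_ratio laurent_scale_monomial_ratio wE //.
rewrite -big_split big1 ?scale1r ?subrr => [|j _ /=]; last first.
  by rewrite -expfzDr ?addrN // torus_weight_neq0.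
exists (fun=> 0), (fun=> 0).
by rewrite !big1 ?addr0 // => *; rewrite mul0r.
Qed.

End PtolemyVariety.

(** * The Ptolemy field *)

Theorem corollary1p16 (R : realType) (T : triangulation)
  (Tconn : connected T) (Tor : oriented T) (sigma : cocycle T)
  (v e : nat) (N : cell_numbering T v e) (eps : 'I_v -> 'I_e)
  (Siso : is_isomorphism (@slice_to_red R T sigma v e N eps))
  (c : ptolemy_red R sigma N) (c' : slice R sigma N eps)
  (c'c : slice_to_red c' = c)
  (c0 : ptolemy_variety R sigma N) (c0c : ptolemy_proj N c0 = c) (z : R[i]) :
  ptolemy_field N c0 z <-> coords_field N (slice_incl c') z.
Proof.
have orb : same_orbit N c0 (slice_incl c').
  by apply: ptolemy_proj_eq; rewrite c0c -c'c.
split=> zP F divF AF; apply: zP => // y.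
  case=> p pinv ->; rewrite (torus_invariant_eval pinv orb).
  by apply: laurent_eval_rat_mem => // i; apply: AF; exists i.
case=> i ->; have [_ [g [_ gK _]]] := Siso.
have [a aE] := slice_weights_span c' (can_inj gK) i.
have pinv := monomial_ratio_invariant sigma aE.
apply: AF; exists (monomial_ratio rat eps i a) => //.
rewrite (torus_invariant_eval pinv orb) lC_monomial_ratio.
rewrite laurent_eval_monomial_ratio big1 ?mulr1 // => j _.
by rewrite (eqP (forallP (valP c') j)) exp1rz.
Qed.
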